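(* Let $\psi$ be a quasiperiodic flow on $T^2$ (generated by a constant vector field) and let $F$ be a real quadratic number field. Then $\psi$ is $F$-algebraic if and only if $M_\psi$ is a finite index subgroup of $\mathfrak{o}_F^*$.
   Context: $T^2=\mathbb{R}^2/\mathbb{Z}^2$ is the $2$-torus with global coordinates $(\theta_1,\theta_2)$. For a smooth ($C^\infty$) flow $\psi:\mathbb{R}\times T^2\to T^2$, its generating vector field is $X_\psi(p)=\frac{d}{dt}\psi(t,p)|_{t=0}$. A constant vector field is one of the form $a_1\,\partial/\partial\theta_1+a_2\,\partial/\partial\theta_2$ with $a_1,a_2\in\mathbb{R}$. A flow generated by a constant vector field is quasiperiodic if the components $a_1,a_2$ are linearly independent over $\mathbb{Q}$. Generalized symmetry group: $S_\psi$ is the group of all $R\in\mathrm{Diff}(T^2)$ (smooth diffeomorphisms) for which there is $\alpha\in\mathbb{R}^*=\mathbb{R}\setminus\{0\}$ with $R_*X_\psi=\alpha X_\psi$, where $R_*X_\psi=\mathbf{T}R\,X_\psi\,R^{-1}$ is the push-forward and $\mathbf{T}R$ is the derivative map of $R$. The unique such $\alpha$ is the multiplier $\rho_\psi(R)$, and the multiplier group is $M_\psi=\rho_\psi(S_\psi)\subset\mathbb{R}^*$. A real quadratic number field is a subfield $F$ of $\mathbb{R}$ of degree $2$ over $\mathbb{Q}$. A quasiperiodic flow $\psi$ on $T^2$ generated by $X_\psi=a_1\,\partial/\partial\theta_1+a_2\,\partial/\partial\theta_2$ is called $F$-algebraic if there is $\vartheta\in\mathbb{R}^*$ such that $\{\vartheta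 a_1,\vartheta a_2\}$ is a $\mathbb{Q}$-basis of $F$. $\mathfrak{o}_F$ denotes the ring of algebraic integers in $F$ and $\mathfrak{o}_F^*$ its group of units. *)

(* Defs.v *)
From HB Require Import structures.
From mathcomp Require Import all_boot all_order all_algebra.
From mathcomp Require Import all_classical all_reals all_analysis.
Import Order.TTheory GRing.Theory Num.Theory.
Import numFieldNormedType.Exports.

Set Implicit Arguments.
Unset Strict Implicit.
Unset Printing Implicit Defensive.

Local Open Scope classical_set_scope.
Local Open Scope ring_scope.

Section SmoothMaps.
Context {R : realType} {V W : normedModType R}.

(* For finite-dimensional V and W and open U, this is the usual C^k: asking for
   the derivative in every direction v amounts to asking for the partial
   derivatives. *)
Fixpoint Ck_on (k : nat) (U : set V) (f : V -> W) : Prop :=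
  (forall x, U x -> {for x, continuous f}) /\
  if k is k'.+1 then
    forall v, (forall x, U x -> derivable f x v) /\ Ck_on k' U ('D_v f)
  else True.

Definition smooth_on (U : set V) (f : V -> W) := forall k, Ck_on k U f.

(* A manifold M is presented here by a map piM : V -> M from its universal cover.
   The local inverses of piM are the charts of M, so f is smooth when it has
   smooth local expressions g, i.e. piN \o g = f \o piM near each point. *)
Context {M N : Type}.
Variables (piM : V -> M) (piN : W -> N).

Definition local_lift (f : M -> N) (x : V) (g : V -> W) : Prop :=
  exists U : set V, [/\ open_nbhs x U, smooth_on U g &
    forall y, U y -> piN (g y) = f (piM y)].

Definition smooth_map (f : M -> N) : Prop := forall x, exists g, local_lift f x g.

(* The derivative at piM x of a smooth f, in the charts given by piM and piN;
   it does not depend on the local expression chosen by `get`. *)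
Definition tangent_map (f : M -> N) (x v : V) : W :=
  'D_v (get (local_lift f x)) x.

End SmoothMaps.

Section Torus.
Context {R : realType}.

Definition Z2 : {pred 'rV[R]_2} := fun x => [forall i, x 0 i \is a Num.int].

Lemma Z2_zmod_closed : zmod_closed Z2.
Proof.
split=> [|x y /forallP Zx /forallP Zy]; apply/forallP => i; rewrite !mxE //.
exact: rpredB.
Qed.

HB.instance Definition _ := GRing.isZmodClosed.Build 'rV[R]_2 Z2 Z2_zmod_closed.

Definition torus := Quotient.quot (GRing.ZmodClosed.clone 'rV[R]_2 Z2 _).

Definition torus_pi (x : 'rV[R]_2) : torus := (\pi_torus x)%qT.

Definition torus_repr (p : torus) : 'rV[R]_2 := repr p.

(* The coordinates (theta_1, theta_2) trivialize the tangent bundle of T^2. *)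
Definition vector_field := torus -> 'rV[R]_2.

Definition torus_tangent (f : torus -> torus) (p : torus) : 'rV[R]_2 -> 'rV[R]_2 :=
  tangent_map torus_pi torus_pi f (torus_repr p).

Record diffeo := Diffeo {
  diffeo_fun : torus -> torus;
  diffeo_inv : torus -> torus;
  diffeo_funK : cancel diffeo_fun diffeo_inv;
  diffeo_invK : cancel diffeo_inv diffeo_fun;
  diffeo_fun_smooth : smooth_map torus_pi torus_pi diffeo_fun;
  diffeo_inv_smooth : smooth_map torus_pi torus_pi diffeo_inv }.

Definition push_forward (h : diffeo) (X : vector_field) : vector_field :=
  fun p => torus_tangent (diffeo_fun h) (diffeo_inv h p) (X (diffeo_inv h p)).

Record smooth_flow (psi : R -> torus -> torus) : Prop := SmoothFlow {
  flow_0 : forall p, psi 0 p = p;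
  flow_D : forall s t p, psi (s + t) p = psi s (psi t p);
  flow_smooth : smooth_map
    (fun x : R^o * 'rV[R]_2 => (x.1, torus_pi x.2)) torus_pi
    (fun z : R * torus => psi z.1 z.2) }.

Definition generator (psi : R -> torus -> torus) : vector_field :=
  fun p => tangent_map (id : R^o -> R) torus_pi (fun t => psi t p) 0 1.

Definition generated_by_constant (psi : R -> torus -> torus) (a : 'rV[R]_2) :=
  forall p, generator psi p = a.

Definition is_multiplier (psi : R -> torus -> torus) (h : diffeo) (alpha : R) :=
  alpha != 0 /\
  forall p, push_forward h (generator psi) p = alpha *: generator psi p.

Definition symmetry_group (psi : R -> torus -> torus) : set diffeo :=
  [set h | exists alpha, is_multiplier psi h alpha].

Definition multiplier (psi : R -> torus -> torus) (h : diffeo) : R :=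
  get (is_multiplier psi h).

Definition multiplier_group (psi : R -> torus -> torus) : set R :=
  multiplier psi @` symmetry_group psi.

End Torus.

Arguments torus R : clear implicits.

Section Arithmetic.
Context {R : realType}.

Definition Qcomb n (c : 'rV[rat]_n) (b : 'rV[R]_n) : R :=
  \sum_(i < n) ratr (c 0 i) * b 0 i.

Definition Qfree n (b : 'rV[R]_n) := forall c, Qcomb c b = 0 -> c = 0.

Definition Qbasis n (F : set R) (b : 'rV[R]_n) :=
  Qfree b /\ F = range (fun c => Qcomb c b).

Definition real_quadratic_field (F : set R) :=
  GRing.divring_closed (mem F) /\ exists b : 'rV[R]_2, Qbasis F b.

Definition ring_of_integers (F : set R) : set R :=
  [set x | F x /\ integralOver (intr : int -> R) x].

Definition unit_group (A : set R) : set R :=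
  [set u | [/\ u != 0, A u & A u^-1]].

Definition finite_index_subgroup (H G : set R) :=
  [/\ H `<=` G, GRing.divr_closed (mem H) &
    finite_set [set [set u * h | h in H] | u in G]].

Definition quasiperiodic (psi : R -> torus R -> torus R) :=
  exists a, generated_by_constant psi a /\ Qfree a.

Definition algebraic_flow (F : set R) (psi : R -> torus R -> torus R) :=
  exists a, generated_by_constant psi a /\
    exists theta : R, theta != 0 /\ Qbasis F (theta *: a).

End Arithmetic.

(* Main.v *)
(* Only the constant generator a of the flow matters. A symmetry h with
   multiplier alpha maps orbits to orbits, h(x + s a) = h(x) + s alpha a; since
   the line R a is dense in the torus, the derivative of h is constant, so h is
   a translation composed with an integer matrix W for which a is an
   eigenvector. Hence the multiplier group consists of the units of the ring O
   of multipliers of the lattice L = Z a_1 + Z a_2.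

   If psi is F-algebraic, then F = Q(d) with d in O and d^2 = D an integer, and
   2 D o_F is contained in O. Two units of o_F whose half-integral coordinates
   are congruent modulo 4 D^2 therefore have a quotient in O, which leaves
   finitely many cosets. Conversely, Pell's equation gives a unit e with
   |e| < 1; a power of e is a multiplier, it is irrational, and it expresses
   a_2 / a_1 as an element of F. *)

Require Import Defs.
From mathcomp Require Import all_boot all_order all_algebra.
From mathcomp Require Import all_classical all_reals all_analysis.
From mathcomp Require Import algC algnum ring.
Import Order.TTheory GRing.Theory Num.Theory.
Import numFieldNormedType.Exports.

Set Implicit Arguments.
Unset Strict Implicit.
Unset Printing Implicit Defensive.

Local Open Scope classical_set_scope.
Local Open Scope ring_scope.

Lemma ord2P (P : 'I_2 -> Prop) : P 0 -> P 1 -> forall i, P i.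
Proof.
move=> P0 P1 [[|[|//]] i2]; first by rewrite (_ : Ordinal i2 = 0)//; apply: val_inj.
by rewrite (_ : Ordinal i2 = 1)//; apply: val_inj.
Qed.

Lemma row2P (T : Type) (u v : 'rV[T]_2) : u 0 0 = v 0 0 -> u 0 1 = v 0 1 -> u = v.
Proof. by move=> e0 e1; apply/rowP; exact: ord2P. Qed.

(** * Linear independence of real numbers over the rationals *)

Section RationalIndependence.
Context {R : realType}.

Lemma irrational_lin (x : R) (a b : rat) : irrational x ->
  ratr a * x + ratr b = 0 -> a = 0 /\ b = 0.
Proof.
move=> xi e; suff a0 : a = 0.
  split=> //; move: e; rewrite a0 rmorph0 mul0r add0r => /eqP.
  by rewrite fmorph_eq0 => /eqP.
apply/eqP/negPn/negP => a0; apply: xi; exists (- b / a) => //.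
apply: (mulfI (x := ratr a)); first by rewrite fmorph_eq0.
rewrite fmorph_div/= mulrCA mulfV ?fmorph_eq0// mulr1 rmorphN /=.
by apply/eqP; rewrite eq_sym -addr_eq0; apply/eqP.
Qed.

Lemma Qcomb2 (c : 'rV[rat]_2) (b : 'rV[R]_2) :
  Qcomb c b = ratr (c 0 0) * b 0 0 + ratr (c 0 1) * b 0 1.
Proof. by rewrite /Qcomb big_ord_recl big_ord1; congr (_ + ratr (c 0 _) * b 0 _); apply: val_inj. Qed.

(** Dividing a relation by [b 0 0] turns independence into irrationality of the slope, the form in
    which the arithmetic below uses it. *)
Lemma Qfree2P (b : 'rV[R]_2) : Qfree b <-> b 0 0 != 0 /\ irrational (b 0 1 / b 0 0).
Proof.
split=> [bf|[b0 bi] c].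
  have b0 : b 0 0 != 0.
    apply/eqP => b0; have := bf (\row_i (i == 0)%:R).
    rewrite Qcomb2 b0 !mxE mulr0 rmorph0 mul0r addr0 => /(_ erefl)/rowP/(_ 0).
    by rewrite !mxE.
  split=> // -[q _ qE].
  have := bf (\row_i if i == 0 then - q else 1).
  rewrite Qcomb2 !mxE /= rmorphN rmorph1 /= qE mulNr divfK// mul1r addNr => /(_ erefl)/rowP/(_ 1).
  by rewrite !mxE => /eqP.
rewrite Qcomb2 => e.
have [] := @irrational_lin _ (c 0 1) (c 0 0) bi.
  by apply: (mulIf b0); rewrite mulrDl mul0r -mulrA divfK// addrC.
by move=> c1 c0; apply: row2P; rewrite ?c0 ?c1 !mxE.
Qed.

End RationalIndependence.

(** The first [#|T| + 1] values already collide; the bound on [j] becomes the bound on the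
    denominator in [dirichlet_approx]. *)
Lemma pigeonhole_nat (T : finType) (f : nat -> T) :
  exists i j, (i < j <= #|T|)%N /\ f i = f j.
Proof.
pose g (i : 'I_#|T|.+1) := f i.
have /injectivePn[i [j ij gij]] : ~~ injectiveb g.
  apply/negP => /injectiveP/leq_card; by rewrite card_ord ltnn.
have [lij|lji|/val_inj e] := ltngtP i j; last by rewrite e eqxx in ij.
- by exists i, j; rewrite lij -ltnS ltn_ord.
- by exists j, i; rewrite lji -ltnS ltn_ord.
Qed.

(** * Diophantine approximation *)

Section Dirichlet.
Context {R : realType}.

(** Dirichlet's box principle: of the fractional parts [r k] with [k] from 0 to [N.+1], two fall
    into the same one of [N.+1] boxes of equal length. *)
Lemma dirichlet_approx (x : R) (N : nat) :
  exists q p : int, [/\ 0 < q <= N.+1%:Z & `|q%:~R * x - p%:~R| < N.+1%:R^-1].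
Proof.
pose r (k : nat) := k%:R * x - (Num.floor (k%:R * x))%:~R.
have r_itv k : 0 <= r k < 1.
  have /andP[h1 h2] := floor_itv (k%:R * x).
  by rewrite subr_ge0 h1 ltrBlDl -intrD1.
have N0 : 0 < N.+1%:R :> R by rewrite ltr0n.
have box k : (`|Num.floor (N.+1%:R * r k)| < N.+1)%N.
  have /andP[r0 r1] := r_itv k.
  have m0 : 0 <= Num.floor (N.+1%:R * r k) by rewrite floor_ge0 mulr_ge0// ltW.
  rewrite -ltz_nat gez0_abs// floor_lt_int -[X in _ < X]mulr1 ltr_pM2l//.
have [i [j [/andP[ij jN] /(congr1 val) /= e]]] := pigeonhole_nat (fun k => Ordinal (box k)).
rewrite card_ord in jN.
exists (Posz (subn j i)), (Num.floor (j%:R * x) - Num.floor (i%:R * x)).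
rewrite ltz_nat subn_gt0 ij lez_nat (leq_trans (leq_subr _ _) jN); split => //.
have -> : (Posz (subn j i))%:~R * x - (Num.floor (j%:R * x) - Num.floor (i%:R * x))%:~R = r j - r i.
  by rewrite -pmulrn natrB ?(ltnW ij)// mulrBl rmorphB /= /r !opprD !opprK addrACA.
(* Scaled by [N.+1], the two fractional parts have the same floor, so they differ by less than
   one. *)
rewrite -(ltr_pM2l N0) mulfV ?gt_eqF// -[X in X * _]gtr0_norm// -normrM mulrBr.
have fl k : (Num.floor (N.+1%:R * r k))%:~R = `|Num.floor (N.+1%:R * r k)|%N%:R :> R.
  have /andP[r0 _] := r_itv k.
  by rewrite natr_absz ger0_norm// floor_ge0 mulr_ge0// ltW.
have /andP[a1 a2] := floor_itv (N.+1%:R * r i).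
have /andP[b1 b2] := floor_itv (N.+1%:R * r j).
move: a1 a2 b1 b2; rewrite !intrD1 !fl e => a1 a2 b1 b2.
rewrite ltr_distl; apply/andP; split.
  by rewrite ltrBlDr (lt_le_trans a2)// lerD2r.
by rewrite (lt_le_trans b2)// lerD2r.
Qed.

(** Dirichlet gives a nonzero [d] in Z x + Z with |d| < e. Its multiples form a grid of mesh |d|,
    and rounding [y / d] down selects one close to [y]. *)
Lemma int_span_dense (x : R) : irrational x ->
  forall (y e : R), 0 < e -> exists m n : int, `|m%:~R * x + n%:~R - y| < e.
Proof.
move=> xi y e e0.
have [N Ne] : exists N : nat, N.+1%:R^-1 < e.
  exists (Num.truncn e^-1); rewrite invf_plt ?posrE// ?ltr0n//.
  by rewrite truncnS_gt.
have [q [p [/andP[q0 _] pq]]] := dirichlet_approx x N.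
pose d := q%:~R * x - p%:~R.
have d0 : d != 0.
  apply: contraTneq q0 => d0; have [|/eqP] := @irrational_lin R x q%:~R (- p)%:~R xi.
    by rewrite !ratr_int rmorphN.
  by rewrite intr_eq0 => /eqP ->.
pose k := Num.floor (y / d).
exists (k * q), (- (k * p)).
have -> : (k * q)%:~R * x + (- (k * p))%:~R - y = d * (k%:~R - y / d).
  rewrite mulrBr [d * (y / d)]mulrCA mulfV// mulr1 /d.
  by ring.
have /andP[k1 k2] := floor_itv (y / d).
rewrite normrM; apply: le_lt_trans (lt_trans pq Ne).
rewrite -[leRHS]mulr1 ler_pM2l ?normr_gt0// distrC ger0_norm ?subr_ge0//.
by rewrite lerBlDl -intrD1 ltW.
Qed.

End Dirichlet.

(** * The multiplier ring of the lattice Z a_1 + Z a_2 *)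

Section LatticeRing.
Context {R : realType}.
Implicit Types (a : 'rV[R]_2) (x y : R).

(* In coordinates: x L is contained in L, where L = Z a_1 + Z a_2. *)
Definition lattice_ring a : set R :=
  [set x | exists W : 'M[int]_2, a *m map_mx intr W = x *: a].

Lemma lattice_ringP a x :
  lattice_ring a x <-> exists p q r s : int,
    x * a 0 0 = p%:~R * a 0 0 + q%:~R * a 0 1 /\
    x * a 0 1 = r%:~R * a 0 0 + s%:~R * a 0 1.
Proof.
have mulE (W : 'M[int]_2) j :
    (a *m map_mx intr W) 0 j = (W 0 j)%:~R * a 0 0 + (W 1 j)%:~R * a 0 1.
  rewrite mxE big_ord_recl big_ord1 !mxE ![_ * a _ _]mulrC.
  by congr (_ * _ + a 0 _ * (W _ j)%:~R); apply: val_inj.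
split=> [[W /rowP aW]|[p [q [r [s [e0 e1]]]]]].
  exists (W 0 0), (W 1 0), (W 0 1), (W 1 1).
  by rewrite -!mulE !aW !mxE.
exists (\matrix_(i, j) if j == 0 then (if i == 0 then p else q) else (if i == 0 then r else s)).
by apply: row2P; rewrite mulE !mxE.
Qed.

Lemma lattice_ring_int a (n : int) : lattice_ring a n%:~R.
Proof.
by apply/lattice_ringP; exists n, 0, 0, n; rewrite !mul0r add0r addr0.
Qed.

Lemma lattice_ring1 a : lattice_ring a 1.
Proof. exact: (lattice_ring_int a 1). Qed.

Lemma lattice_ringD a x y :
  lattice_ring a x -> lattice_ring a y -> lattice_ring a (x + y).
Proof.
move=> [W aW] [W' aW']; exists (W + W').
by rewrite map_mxD mulmxDr aW aW' scalerDl.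
Qed.

Lemma lattice_ringM a x y :
  lattice_ring a x -> lattice_ring a y -> lattice_ring a (x * y).
Proof.
move=> [W aW] [W' aW']; exists (W *m W').
by rewrite map_mxM mulmxA aW -scalemxAl aW' scalerA.
Qed.

(** Such an [x] is an eigenvalue of an integer matrix, hence a root of its characteristic
    polynomial. *)
Lemma lattice_ring_integral a x : a != 0 -> lattice_ring a x ->
  integralOver (intr : int -> R) x.
Proof.
move=> a0 [W aW]; exists (char_poly W); first exact: char_poly_monic.
rewrite map_char_poly -eigenvalue_root_char.
by apply/eigenvalueP; exists a.
Qed.

Lemma lattice_ring_rat_span a x : a 0 0 != 0 -> lattice_ring a x ->
  exists p q : int, x = p%:~R + q%:~R * (a 0 1 / a 0 0).
Proof.
move=> a0 /lattice_ringP[p [q [_ [_ [e _]]]]]; exists p, q.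
by apply: (mulIf a0); rewrite e; field.
Qed.

(** The element is a square root of the discriminant B^2 - 4AC. It sends a_1 to B a_1 + 2A a_2 and,
    by the quadratic equation, a_2 to -2C a_1 - B a_2. *)
Lemma lattice_ring_quadratic a (A B C : int) : a 0 0 != 0 ->
  let l := a 0 1 / a 0 0 in
  A%:~R * l ^+ 2 + B%:~R * l + C%:~R = 0 ->
  lattice_ring a (2 * A%:~R * l + B%:~R).
Proof.
move=> a0 l lABC; apply/lattice_ringP.
exists B, (2 * A), (- 2 * C), (- B).
have la : a 0 1 = l * a 0 0 by rewrite divfK.
rewrite la; split; first by ring.
apply/eqP; rewrite -subr_eq0; apply/eqP.
have -> : 0 = 2 * (A%:~R * l ^+ 2 + B%:~R * l + C%:~R) * a 0 0 by rewrite lABC mulr0 mul0r.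
ring.
Qed.

End LatticeRing.

(** * Quadratic fields generated by a square root *)

Section QuadraticField.
Context {R : realType}.
Implicit Types (F : set R) (d x y : R).

Lemma divring_closedP F : GRing.divring_closed (mem F) <->
  [/\ F 1, forall x y, F x -> F y -> F (x - y) & forall x y, F x -> F y -> F (x / y)].
Proof.
split=> [[F1 FB FV]|[F1 FB FV]]; split.
- exact/set_mem.
- by move=> x y /mem_set Fx /mem_set Fy; apply/set_mem/FB.
- by move=> x y /mem_set Fx /mem_set Fy; apply/set_mem/FV.
- exact/mem_set.
- by move=> x y /set_mem Fx /set_mem Fy; apply/mem_set/FB.
- by move=> x y /set_mem Fx /set_mem Fy; apply/mem_set/FV.
Qed.

(** Presents F as Q(d). The integer [D] may have square factors: in practice it is the discriminant
    of whatever quadratic equation the slope satisfies. *)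
Definition sqrt_generated F d (D : int) :=
  [/\ irrational d, d ^+ 2 = D%:~R &
    forall x, F x <-> exists u v : rat, x = ratr u + ratr v * d].

(** Dividing the basis by its first element gives the basis 1, l. Since F is a field, l^2 = u + v l
    with u and v rational; clearing denominators and completing the square produces the
    generator. *)
Lemma Qbasis_sqrt_generated F (b : 'rV[R]_2) :
  GRing.divring_closed (mem F) -> Qbasis F b ->
  let l := b 0 1 / b 0 0 in
  exists A B C : int, A%:~R * l ^+ 2 + B%:~R * l + C%:~R = 0 /\
    sqrt_generated F (2 * A%:~R * l + B%:~R) (B ^+ 2 - 4 * A * C).
Proof.
move=> /divring_closedP[F1 FB FV] [bf FE] l.
have [b0 li] := (Qfree2P b).1 bf; rewrite -[_ / _]/l in li.
have FP x : F x <-> exists u v : rat, x = ratr u * b 0 0 + ratr v * b 0 1.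
  rewrite FE; split=> [[c _ <-]|[u [v ->]]].
    by exists (c 0 0), (c 0 1); rewrite Qcomb2.
  by exists (\row_i if i == 0 then u else v) => //; rewrite Qcomb2 !mxE.
have Fb0 : F (b 0 0) by apply/FP; exists 1, 0; rewrite rmorph1 rmorph0; ring.
have Fb1 : F (b 0 1) by apply/FP; exists 0, 1; rewrite rmorph1 rmorph0; ring.
have FM x y : F x -> F y -> F (x * y).
  by move=> Fx Fy; rewrite -[y]invrK; apply: (FV) => //; rewrite -div1r; apply: FV.
have FlP x : F x <-> exists u v : rat, x = ratr u + ratr v * l.
  split=> [Fx|[u [v ->]]].
    have /FP[u [v xE]] := FM _ _ Fx Fb0; exists u, v.
    by apply: (mulIf b0); rewrite xE /l; field.
  rewrite (_ : _ + _ = (ratr u * b 0 0 + ratr v * b 0 1) / b 0 0); last by rewrite /l; field.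
  by apply: (FV) => //; apply/FP; exists u, v.
have Fl : F l by exact: FV.
have /FlP[u [v l2]] := FM _ _ Fl Fl.
pose A := denq u * denq v; pose B := - (numq v * denq u); pose C := - (numq u * denq v).
have A0 : A != 0 by rewrite mulf_neq0// denq_neq0.
have uE : (denq u)%:~R * ratr u = (numq u)%:~R :> R.
  by rewrite -[in LHS]ratr_int -[RHS]ratr_int -rmorphM /= numqE mulrC.
have vE : (denq v)%:~R * ratr v = (numq v)%:~R :> R.
  by rewrite -[in LHS]ratr_int -[RHS]ratr_int -rmorphM /= numqE mulrC.
have lABC : A%:~R * l ^+ 2 + B%:~R * l + C%:~R = 0.
  rewrite expr2 l2 /A /B /C !rmorphN !rmorphM /= -uE -vE; ring.
(* The origin of the coefficients is forgotten here; only the equation and the nonvanishing of [A]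
   matter below. *)
move: A B C A0 lABC => A B C A0 lABC {uE vE}; exists A, B, C; split=> //.
have AR0 : A%:~R != 0 :> R by rewrite intr_eq0.
have A2R0 : 2 * A%:~R != 0 :> R by rewrite mulf_neq0// pnatr_eq0.
set d := 2 * A%:~R * l + B%:~R.
have ld : l = (d - B%:~R) / (2 * A%:~R) by rewrite /d; field.
split.
- move=> [q _ qd]; apply: li; exists ((q - B%:~R) / (2 * A%:~R)) => //.
  by rewrite fmorph_div rmorphB rmorphM /= !ratr_int ratr_nat qd -ld.
- rewrite /d.
  apply/eqP; rewrite -subr_eq0; apply/eqP.
  (* Completing the square: (2Al + B)^2 - (B^2 - 4AC) = 4A(Al^2 + Bl + C). *)
  have -> : 0 = 4 * A%:~R * (A%:~R * l ^+ 2 + B%:~R * l + C%:~R) by rewrite lABC mulr0.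
  ring.
- move=> x; rewrite FlP; split=> -[p [q ->]].
    exists (p - q * B%:~R / (2 * A%:~R)), (q / (2 * A%:~R)).
    rewrite rmorphB !fmorph_div !rmorphM /= !ratr_int ratr_nat {1}ld; field.
    by rewrite AR0.
  exists (p + q * B%:~R), (2 * A%:~R * q).
  by rewrite rmorphD !rmorphM /= !ratr_int ratr_nat /d; ring.
Qed.

End QuadraticField.

(** * Algebraic integers of a quadratic field *)

Section QuadraticIntegers.
Context {R : realType}.
Implicit Types (F : set R) (d x y : R).
Local Notation integral := (integralOver (intr : int -> R)).

(** The polynomial equation descends from the reals to the rationals and is then carried to [algC],
    where rational algebraic integers are known to be integers. *)
Lemma rat_integral_int (x : rat) : integral (ratr x) -> x \is a Num.int.
Proof.
case=> p p_monic; have -> : map_poly intr p = map_poly ratr (map_poly intr p : {poly rat}) :> {poly R}.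
  by rewrite -map_poly_comp; apply: eq_map_poly => n /=; rewrite ratr_int.
rewrite fmorph_root => px.
have xA : ratr x \in Aint.
  apply: (@root_monic_Aint (map_poly intr p)).
  - have -> : map_poly intr p = map_poly ratr (map_poly intr p : {poly rat}) :> {poly algC}.
      by rewrite -map_poly_comp; apply: eq_map_poly => n /=; rewrite ratr_int.
    by rewrite fmorph_root.
  - exact: monic_map.
  - by apply/polyOverP => i; rewrite coef_map intr_int.
have /intrP[m xm] := Cint_rat_Aint (Crat_rat x) xA.
apply/intrP; exists m; apply: (fmorph_inj (ratr : rat -> algC)).
by rewrite /= xm ratr_int.
Qed.

Lemma irrational_neq0 d : irrational d -> d != 0.
Proof. by move=> di; apply/eqP => d0; apply: di; exists 0; rewrite // rmorph0 d0. Qed.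

Lemma sqrt_integral d (D : int) : d ^+ 2 = D%:~R -> integral d.
Proof.
move=> dD; exists ('X^2 - D%:P); first exact: monicXnsubC.
by rewrite rmorphB /= map_polyXn map_polyC /root !hornerE dD subrr.
Qed.

(** The conjugation d -> -d commutes with integer polynomials; the induction follows Horner's
    scheme, reducing d^2 to [D]. *)
Lemma horner_sqrt_conj d (D : int) (u v : rat) (p : {poly int}) : d ^+ 2 = D%:~R ->
  exists s t : rat,
    (map_poly intr p).[ratr u + ratr v * d] = ratr s + ratr t * d /\
    (map_poly intr p).[ratr u - ratr v * d] = ratr s - ratr t * d.
Proof.
move=> dD; elim/poly_ind: p => [|p c [s [t [e1 e2]]]].
  by exists 0, 0; rewrite rmorph0 !horner0 rmorph0; split; ring.
exists (s * u + t * v * D%:~R + c%:~R), (s * v + t * u).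
have -> : ratr (s * u + t * v * D%:~R + c%:~R) =
    ratr s * ratr u + ratr t * ratr v * d ^+ 2 + c%:~R :> R.
  by rewrite !rmorphD !rmorphM /= !ratr_int dD.
have -> : ratr (s * v + t * u) = ratr s * ratr v + ratr t * ratr u :> R.
  by rewrite rmorphD !rmorphM.
have hornerE' x : (map_poly intr (p * 'X + c%:P)).[x] = (map_poly intr p).[x] * x + c%:~R :> R.
  by rewrite rmorphD rmorphM /= map_polyX map_polyC hornerMXaddC.
rewrite !hornerE' e1 e2.
by split; ring.
Qed.

(** A polynomial vanishing at one conjugate vanishes at the other, because irrationality of [d]
    kills both coordinates of its value. *)
Lemma integral_sqrt_conj d (D : int) (u v : rat) : irrational d -> d ^+ 2 = D%:~R ->
  integral (ratr u + ratr v * d) -> integral (ratr u - ratr v * d).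
Proof.
move=> di dD [p p_monic /eqP px]; exists p => //; apply/eqP.
have [s [t [e1 e2]]] := horner_sqrt_conj u v p dD.
have [t0 s0] : t = 0 /\ s = 0 by apply: (irrational_lin di); rewrite addrC -e1.
by rewrite e2 t0 s0 !rmorph0 mul0r subrr.
Qed.

(** With x' the conjugate of x = u + v d, the rationals x + x' = 2u and (x - x') d = 2Dv are
    integral, hence integers. *)
Lemma sqrt_generated_integers F d (D : int) x : sqrt_generated F d D ->
  ring_of_integers F x ->
  exists X Y : int, x = X%:~R / 2 + Y%:~R * d / (2 * D%:~R).
Proof.
move=> [di dD FP] [/FP[u [v xE]] xi].
have xi' : integral (ratr u - ratr v * d).
  by apply: (integral_sqrt_conj di dD); rewrite -xE.
have d0 := irrational_neq0 di.
have D0 : D%:~R != 0 :> R by rewrite -dD expf_neq0.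
have /intrP[X XE] : 2 * u \is a Num.int.
  apply: rat_integral_int; have := integral_add xi xi'.
  by congr integralOver; rewrite xE rmorphM /= ratr_nat; ring.
have /intrP[Y YE] : 2 * D%:~R * v \is a Num.int.
  apply: rat_integral_int; have := integral_mul (integral_sub xi xi') (sqrt_integral dD).
  by congr integralOver; rewrite xE !rmorphM /= ratr_nat ratr_int -dD; ring.
exists X, Y; rewrite xE -(ratr_int R X) -(ratr_int R Y) -XE -YE !rmorphM /= ratr_nat ratr_int.
by field.
Qed.

End QuadraticIntegers.

(** * Finite index of the units of the lattice ring *)

Section FiniteIndex.
Context {R : realType}.
Implicit Types (F : set R) (a : 'rV[R]_2) (d x y : R).

(** A finite colouring that separates the values of [f]. It is a relation because the coordinates
    that define the colour are only known to exist. *)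
Lemma finite_image_separated (T : finType) (U : choiceType) (W : Type) (A : set U) (f : U -> W)
    (r : U -> T -> Prop) :
  (forall u, A u -> exists t, r u t) ->
  (forall u v t, A u -> A v -> r u t -> r v t -> f u = f v) ->
  finite_set (f @` A).
Proof.
move=> rtot rsep; have [->|/set0P[u0 Au0]] := eqVneq A set0.
  by rewrite image_set0; exact: finite_set0.
pose g t := f (xget u0 [set u | A u /\ r u t]).
apply: (@sub_finite_set _ _ (g @` setT)); last exact/finite_image/finite_finset.
move=> _ [u Au <-]; have [t rt] := rtot u Au; exists t => //.
have [Av rv] : [set u | A u /\ r u t] (xget u0 [set u | A u /\ r u t]) by apply: xgetPex; exists u.
exact: rsep Av Au rv rt.
Qed.

(** For rationally independent [a], [multiplier_groupP] identifies this set with the multiplier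
    group of the flow. *)
Definition lattice_units a : set R :=
  [set x | [/\ x != 0, lattice_ring a x & lattice_ring a x^-1]].

Lemma lattice_units_divr_closed a : GRing.divr_closed (mem (lattice_units a)).
Proof.
split; first by apply/mem_set; split; rewrite ?oner_neq0// ?invr1; exact: lattice_ring1.
move=> x y /set_mem[x0 ax ax'] /set_mem[y0 ay ay']; apply/mem_set; split.
- by rewrite mulf_neq0// invr_eq0.
- exact: lattice_ringM.
- by rewrite invf_div; exact: lattice_ringM.
Qed.

Lemma lattice_units_coset_eq a x y : y != 0 -> lattice_units a (x / y) ->
  [set x * h | h in lattice_units a] = [set y * h | h in lattice_units a].
Proof.
move=> y0 axy; have [xy0 _ _] := axy.
have x0 : x != 0 by apply: contra_neq xy0 => ->; rewrite mul0r.
have mul u v : lattice_units a u -> lattice_units a v -> lattice_units a (u * v).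
  move=> [u0 au au'] [v0 av av']; split; [exact: mulf_neq0|exact: lattice_ringM|].
  by rewrite invfM; exact: lattice_ringM.
have inv u : lattice_units a u -> lattice_units a u^-1.
  by move=> [u0 au au']; split; rewrite ?invrK ?invr_eq0.
apply/seteqP; split=> _ [h ah <-].
  by exists (x / y * h); [exact: mul|field].
exists ((x / y)^-1 * h); first by apply: mul => //; exact: inv.
by field; rewrite ?x0 ?y0.
Qed.

(** Write x / y = 1 + (x - y) y^-1. The congruences give x - y = 2D (kD + l d), and the factor 2D
    clears the denominators of the integer y^-1, so both factors land in Z[d]. *)
Lemma lattice_ring_divr_congr F a d (D : int) x y (X Y X' Y' k l : int) :
  sqrt_generated F d D -> lattice_ring a d ->
  unit_group (ring_of_integers F) y ->
  x = X%:~R / 2 + Y%:~R * d / (2 * D%:~R) ->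
  y = X'%:~R / 2 + Y'%:~R * d / (2 * D%:~R) ->
  X - X' = 4 * D ^+ 2 * k -> Y - Y' = 4 * D ^+ 2 * l ->
  lattice_ring a (x / y).
Proof.
move=> sF ad [y0 _ Fy] xE yE XX YY.
have [di dD FP] := sF.
have D0 : D%:~R != 0 :> R by rewrite -dD expf_neq0// irrational_neq0.
have [X1 [Y1 y1E]] := sqrt_generated_integers sF Fy.
have xy : x - y = (2 * D%:~R) * ((k * D)%:~R + l%:~R * d).
  have XE : X = X' + 4 * D ^+ 2 * k by rewrite -XX addrC subrK.
  have YE : Y = Y' + 4 * D ^+ 2 * l by rewrite -YY addrC subrK.
  by rewrite xE yE XE YE; field.
have -> : x / y = 1 + ((k * D)%:~R + l%:~R * d) * ((D * X1)%:~R + Y1%:~R * d).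
  have -> : x / y = 1 + (x - y) * y^-1 by field.
  by rewrite xy y1E; congr (1 + _); field.
have aD (m n : int) : lattice_ring a (m%:~R + n%:~R * d).
  by apply: lattice_ringD; [|apply: lattice_ringM => //]; exact: lattice_ring_int.
by apply: lattice_ringD; [exact: lattice_ring1|exact: lattice_ringM].
Qed.

Lemma lattice_units_finite_index F a : a 0 0 != 0 ->
  GRing.divring_closed (mem F) -> F (a 0 1 / a 0 0) ->
  forall d D, sqrt_generated F d D -> lattice_ring a d ->
  finite_index_subgroup (lattice_units a) (unit_group (ring_of_integers F)).
Proof.
move=> a0 /divring_closedP[F1 FB FV] Fl d D sF ad; have [di dD FP] := sF.
have an0 : a != 0 by apply: contra_neq a0 => ->; rewrite mxE.
split.
(* Elements of the lattice ring are integral, and lie in F as rational combinations of 1 and the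
   slope. *)
- move=> x [x0 ax ax'].
  have Fint y : lattice_ring a y -> ring_of_integers F y.
    move=> ay; split; last exact: (lattice_ring_integral an0).
    have [p [q ->]] := lattice_ring_rat_span a0 ay.
    have /FP[u [v ->]] := Fl; apply/FP.
    exists (p%:~R + q%:~R * u), (q%:~R * v).
    by rewrite rmorphD !rmorphM /= !ratr_int; ring.
  by split=> //; exact: Fint.
- exact: lattice_units_divr_closed.
have D0 : D%:~R != 0 :> R by rewrite -dD expf_neq0// irrational_neq0.
pose m := 4 * D ^+ 2.
have m0 : m != 0 by rewrite mulf_neq0// expf_neq0// -(intr_eq0 R).
(* Residues modulo [m] lie below [|m|]; the extra slot provides the successor that [inord]
   requires. *)
pose res (X : int) : 'I_`|m|.+1 := inord `|(X %% m)%Z|.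
have resP X X' : res X = res X' -> exists k, X - X' = m * k.
  have resK Z : Posz (res Z) = (Z %% m)%Z.
    have Z0 : 0 <= (Z %% m)%Z by exact: modz_ge0.
    by rewrite inordK ?gez0_abs// ltnS -lez_nat gez0_abs// abszE ltW// ltz_mod.
  move=> /(congr1 (Posz \o val)) /=; rewrite !resK => e.
  exists ((X %/ m)%Z - (X' %/ m)%Z).
  by rewrite {1}(divz_eq X m) {1}(divz_eq X' m) e; ring.
pose r (x : R) (t : 'I_`|m|.+1 * 'I_`|m|.+1) := exists X Y : int,
  x = X%:~R / 2 + Y%:~R * d / (2 * D%:~R) /\ t = (res X, res Y).
apply: (@finite_image_separated _ _ _ _ _ r) => [u [_ /(sqrt_generated_integers sF)[X [Y uE]] _]|].
  by exists (res X, res Y), X, Y.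
move=> u v _ Gu Gv [X [Y [uE ->]]] [X' [Y' [vE [/resP[k' XX'] /resP[l' YY']]]]].
(* Equal cosets require both [u / v] and [v / u] in the lattice ring, so the congruences are also
   needed reversed. *)
have XX : X' - X = m * - k' by rewrite mulrN -XX' opprB.
have YY : Y' - Y = m * - l' by rewrite mulrN -YY' opprB.
have [u0 _ _] := Gu; have [v0 _ _] := Gv.
apply: lattice_units_coset_eq => //; split; first by rewrite mulf_neq0// invr_eq0.
  exact: (lattice_ring_divr_congr sF ad Gv uE vE XX' YY').
by rewrite invf_div; apply: (lattice_ring_divr_congr sF ad Gu vE uE XX YY).
Qed.

End FiniteIndex.

(** * Pell's equation *)

Section Pell.
Context {R : realType}.
Implicit Types (d : R) (D : int).

Lemma norm_factor d D (p q : int) : d ^+ 2 = D%:~R ->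
  (p ^+ 2 - D * q ^+ 2)%:~R = (p%:~R - q%:~R * d) * (p%:~R + q%:~R * d) :> R.
Proof.
by move=> dD; transitivity (p%:~R ^+ 2 - D%:~R * q%:~R ^+ 2 : R); [|rewrite -dD]; ring.
Qed.

(** The point is that [K] does not depend on [t]: if |p - q d| < 1/(N+1) and q <= N+1, the conjugate
    is at most 1 + 2(N+1)|d|, so the norm is at most 1 + 2|d|. *)
Lemma small_bounded_norm d D : irrational d -> d ^+ 2 = D%:~R ->
  exists K : nat, forall t : R, 0 < t -> exists p q : int,
    0 < `|p%:~R - q%:~R * d| < t /\ `|p ^+ 2 - D * q ^+ 2| <= K%:Z.
Proof.
move=> di dD; exists (Num.truncn (1 + 2 * `|d|)).+1 => t t0.
have [N Nt] : exists N : nat, N.+1%:R^-1 < t.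
  exists (Num.truncn t^-1); rewrite invf_plt ?posrE// ?ltr0n//.
  by rewrite truncnS_gt.
have [q [p [/andP[q0 qN]]]] := dirichlet_approx d N; rewrite distrC => pq.
exists p, q; split.
  rewrite (lt_trans pq Nt) andbT normr_gt0; apply: contraTneq q0 => e.
  have [|/eqP] := @irrational_lin R d (- q)%:~R p%:~R di.
    by rewrite !ratr_int rmorphN /= mulNr addrC.
  by rewrite intr_eq0 oppr_eq0 => /eqP ->.
have N0 : 0 < N.+1%:R :> R by rewrite ltr0n.
rewrite -(ler_int R) intr_norm -pmulrn; apply/ltW/(le_lt_trans _ (truncnS_gt _)).
rewrite (norm_factor p q dD).
have -> : p%:~R + q%:~R * d = p%:~R - q%:~R * d + 2 * q%:~R * d by ring.
have qNR : `|q%:~R| <= N.+1%:R :> R.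
  by rewrite -intr_norm pmulrn ler_int gtr0_norm.
have N1 : N.+1%:R^-1 <= 1 :> R by rewrite invf_le1// ler1n.
rewrite normrM; apply: (@le_trans _ _ (N.+1%:R^-1 * (1 + 2 * N.+1%:R * `|d|))).
  apply: ler_pM => //; first exact: ltW.
  apply: le_trans (ler_normD _ _) _; apply: lerD; first by rewrite (le_trans (ltW pq)).
  by rewrite !normrM normr_nat ler_wpM2r// ler_wpM2l.
rewrite mulrDr mulr1 lerD//.
by rewrite le_eqVlt; apply/orP; left; apply/eqP; field; rewrite gt_eqF.
Qed.

(* Two lattice points of equal norm n, congruent modulo n, have a quotient of
   norm 1 with integer coordinates. *)
Lemma congruent_norm_quotient d D (n p q p' q' k l : int) : irrational d -> d ^+ 2 = D%:~R ->
  p ^+ 2 - D * q ^+ 2 = n -> p' ^+ 2 - D * q' ^+ 2 = n -> n != 0 ->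
  p = p' + n * k -> q = q' + n * l ->
  exists X Y : int, X ^+ 2 - D * Y ^+ 2 = 1 /\
    X%:~R + Y%:~R * d = (p'%:~R - q'%:~R * d) / (p%:~R - q%:~R * d).
Proof.
move=> di dD np np' n0 pE qE.
pose v (p q : int) : R := p%:~R - q%:~R * d; pose w (p q : int) : R := p%:~R + q%:~R * d.
exists (1 + k * p' - D * l * q'), (l * p' - k * q').
have nR0 : n%:~R != 0 :> R by rewrite intr_eq0.
have vw : v p q * w p q = n%:~R by rewrite -np -(norm_factor _ _ dD).
have vw' : v p' q' * w p' q' = n%:~R by rewrite -np' -(norm_factor _ _ dD).
have [v0 w0] : v p q != 0 /\ w p q != 0.
  by apply/andP; rewrite -negb_or -mulf_eq0 vw.
have wXY : w (1 + k * p' - D * l * q') (l * p' - k * q') = 1 + v p' q' * (k%:~R + l%:~R * d).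
  apply/eqP; rewrite -subr_eq0; apply/eqP.
  transitivity ((d ^+ 2 - D%:~R) * l%:~R * q'%:~R); last by rewrite dD subrr !mul0r.
  by rewrite /w /v; ring.
have vXY : v (1 + k * p' - D * l * q') (l * p' - k * q') = 1 + w p' q' * (k%:~R - l%:~R * d).
  apply/eqP; rewrite -subr_eq0; apply/eqP.
  transitivity ((d ^+ 2 - D%:~R) * l%:~R * q'%:~R); last by rewrite dD subrr !mul0r.
  by rewrite /w /v; ring.
have wE : w (1 + k * p' - D * l * q') (l * p' - k * q') = v p' q' / v p q.
  apply: (mulIf v0); rewrite divfK//; apply: (mulIf w0); rewrite -mulrA vw.
  have -> : w p q = w p' q' + n%:~R * (k%:~R + l%:~R * d) by rewrite pE qE /w; ring.
  by rewrite mulrDr vw' wXY; ring.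
have vE : v (1 + k * p' - D * l * q') (l * p' - k * q') = w p' q' / w p q.
  apply: (mulIf w0); rewrite divfK//; apply: (mulIf v0); rewrite -mulrA [w p q * _]mulrC vw.
  have -> : v p q = v p' q' + n%:~R * (k%:~R - l%:~R * d) by rewrite pE qE /v; ring.
  by rewrite mulrDr [w p' q' * v p' q']mulrC vw' vXY; ring.
split; last exact: wE.
apply: (@intr_inj R); rewrite (norm_factor _ _ dD).
rewrite -[X in X * _]/(v _ _) -[X in _ * X]/(w _ _) wE vE.
by rewrite mulrACA -invfM [w p' q' * _]mulrC vw' [w p q * _]mulrC vw mulfV.
Qed.

(** Among infinitely many points of bounded norm with |p - q d| strictly decreasing, two have the
    same norm and the same residues modulo it; the later one divided by the earlier one is the
    unit. *)
Lemma pell_unit d D : irrational d -> d ^+ 2 = D%:~R ->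
  exists X Y : int, X ^+ 2 - D * Y ^+ 2 = 1 /\ 0 < `|X%:~R + Y%:~R * d| < 1.
Proof.
move=> di dD; have [K HK] := small_bounded_norm di dD.
pose v (z : int * int) : R := z.1%:~R - z.2%:~R * d.
pose nm (z : int * int) : int := z.1 ^+ 2 - D * z.2 ^+ 2.
have /choice[g gP] : forall t : R, exists z : int * int,
    0 < t -> 0 < `|v z| < t /\ `|nm z| <= K%:Z.
  (* The pair (0, 0) is a dummy value; [g] is evaluated at positive arguments only. *)
  move=> t; have [t0|_] := ltP 0 t; last by exists (0, 0).
  by have [p [q pq]] := HK t t0; exists (p, q).
pose z n := iter n (fun y => g `|v y|) (g 1).
have v0 n : 0 < `|v (z n)|.
  by elim: n => [|n IHn]; [have [/andP[]] := gP 1 ltr01|have [/andP[]] := gP _ IHn].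
have zK n : `|nm (z n)| <= K%:Z.
  by case: n => [|n]; [have [] := gP 1 ltr01|have [] := gP _ (v0 n)].
have v_decr i j : (i < j)%N -> `|v (z j)| < `|v (z i)|.
  have vS n : `|v (z n.+1)| < `|v (z n)| by have [/andP[]] := gP _ (v0 n).
  elim: j => // j IHj; rewrite ltnS leq_eqVlt => /predU1P[->|/IHj]; first exact: vS.
  exact/lt_trans/vS.
(* As p - q d is nonzero, norm zero would mean p + q d = 0, whence p = q = 0 by irrationality. *)
have nm0 n : nm (z n) != 0.
  apply/eqP => e; have : (nm (z n))%:~R = v (z n) * ((z n).1%:~R + (z n).2%:~R * d).
    exact: norm_factor.
  rewrite e => /esym/eqP; rewrite mulf_eq0 -normr_eq0 gt_eqF//= addrC => /eqP e'.
  have [|z2 z1] := @irrational_lin R d (z n).2%:~R (z n).1%:~R di.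
    by rewrite !ratr_int.
  have := v0 n; rewrite /v normr_gt0.
  move/eqP: z2; move/eqP: z1; rewrite !intr_eq0 => /eqP -> /eqP ->.
  by rewrite mul0r subr0 eqxx.
(* The norm is recorded by sign and absolute value; residues modulo it are smaller than its absolute
   value, so they fit into ['I_K.+1] too. *)
pose cls n : bool * 'I_K.+1 * 'I_K.+1 * 'I_K.+1 :=
  (nm (z n) < 0, inord `|nm (z n)|, inord `|((z n).1 %% nm (z n))%Z|, inord `|((z n).2 %% nm (z n))%Z|).
have [i [j [/andP[ij _] [sg ab c1 c2]]]] := pigeonhole_nat cls.
have inK n x : (absz (x %% nm (z n))%Z < K.+1)%N.
  by rewrite ltnS -lez_nat abszE ger0_norm ?modz_ge0// (le_trans _ (zK n))// ltW// ltz_mod.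
have nij : nm (z i) = nm (z j).
  move/(congr1 val): ab; rewrite /= !inordK// ?ltnS -?lez_nat ?abszE// => ab.
  by rewrite [LHS]intEsign [RHS]intEsign sg ab.
have dvd (x y : int) : (inord `|(x %% nm (z i))%Z| = inord `|(y %% nm (z j))%Z| :> 'I_K.+1) ->
    exists k, x = y + nm (z i) * k.
  move=> /(congr1 (Posz \o val)) /=; rewrite !inordK// ?gez0_abs ?modz_ge0// nij => e.
  exists ((x %/ nm (z j))%Z - (y %/ nm (z j))%Z).
  by rewrite {1}(divz_eq x (nm (z j))) {1}(divz_eq y (nm (z j))) e; ring.
have [k zk] := dvd _ _ c1; have [l zl] := dvd _ _ c2.
have [X [Y [XY XYE]]] := congruent_norm_quotient di dD erefl (esym nij) (nm0 i) zk zl.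
exists X, Y; split=> //; rewrite XYE -[X in X / _]/(v (z j)) -[X in _ / X]/(v (z i)).
by rewrite normrM normfV divr_gt0 ?v0//= ltr_pdivrMr ?v0// mul1r v_decr.
Qed.

End Pell.

(** * From finite index back to the field *)

Section Converse.
Context {R : realType}.
Implicit Types (F : set R) (a : 'rV[R]_2) (d x y : R).

Lemma finite_set_repeat (T : Type) (A : set T) (f : nat -> T) :
  finite_set A -> (forall n, A (f n)) -> exists i j, (i < j)%N /\ f i = f j.
Proof.
move=> Afin Af; apply: contrapT => nrep.
have finj : injective f.
  move=> i j e; have [ij|ji|//] := ltngtP i j; exfalso; apply: nrep.
  - by exists i, j.
  - by exists j, i.
have fA : f @^-1` A = setT by apply/seteqP; split=> // n _; exact: Af.
apply: infinite_nat; rewrite -fA; apply: finite_preimage Afin.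
by move=> i j _ _; exact: finj.
Qed.

(** Norm one makes the conjugate the inverse, and Z[d] is stable under powers and consists of
    integers of F. *)
Lemma sqrt_generated_unit_expr F d (D X Y : int) (n : nat) :
  sqrt_generated F d D -> X ^+ 2 - D * Y ^+ 2 = 1 ->
  unit_group (ring_of_integers F) ((X%:~R + Y%:~R * d) ^+ n).
Proof.
move=> [di dD FP] XY; set e := X%:~R + _; pose e' := X%:~R - Y%:~R * d.
have ee' : e * e' = 1 by rewrite mulrC -(norm_factor _ _ dD) XY.
have e0 : e != 0 by apply: contra_eq_neq ee' => ->; rewrite mul0r eq_sym oner_neq0.
have eV : e^-1 = e' by apply: (mulfI e0); rewrite mulfV.
have intF (X' Y' : int) : ring_of_integers F (X'%:~R + Y'%:~R * d).
  split; first by apply/FP; exists X'%:~R, Y'%:~R; rewrite !ratr_int.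
  by apply: integral_add; [|apply: integral_mul; last exact: sqrt_integral dD]; exact: integral_id.
have powF (X1 Y1 : int) : ring_of_integers F ((X1%:~R + Y1%:~R * d) ^+ n).
  have [X' [Y' ->]] : exists X' Y' : int, (X1%:~R + Y1%:~R * d) ^+ n = X'%:~R + Y'%:~R * d.
    elim: n => [|n [X' [Y' IHn]]]; first by exists 1, 0; rewrite expr0 mul0r addr0.
    exists (X1 * X' + D * Y1 * Y'), (X1 * Y' + Y1 * X'); rewrite exprS IHn.
    transitivity (X1%:~R * X'%:~R + d ^+ 2 * Y1%:~R * Y'%:~R + (X1%:~R * Y'%:~R + Y1%:~R * X'%:~R) * d : R);
      [|rewrite dD]; ring.
  exact: intF.
split; [exact: expf_neq0|exact: powF|].
rewrite -exprVn eV /e' -mulNr; have := powF X (- Y); by rewrite rmorphN.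
Qed.

(** With [q = 0], [x] would be a nonzero integer of absolute value below one. *)
Lemma lattice_unit_irrational a x : a 0 0 != 0 -> lattice_units a x -> `|x| < 1 ->
  exists p q : int, q != 0 /\ x = p%:~R + q%:~R * (a 0 1 / a 0 0).
Proof.
move=> a0 [x0 ax _] x1; have [p [q xE]] := lattice_ring_rat_span a0 ax.
exists p, q; split=> //; apply: contraTneq x1 => q0.
move: x0; rewrite xE q0 mul0r addr0 -leNgt intr_eq0 -intr_norm => p0.
by rewrite -[1]/(1%:~R) ler_int -gtz0_ge1 normr_gt0.
Qed.

(** Two powers of a Pell unit share a coset, so a positive power is a lattice unit of absolute value
    below one; its expression in 1 and the slope can be solved for the slope. *)
Lemma finite_index_slope F a d (D : int) : a 0 0 != 0 ->
  GRing.divring_closed (mem F) -> sqrt_generated F d D ->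
  finite_index_subgroup (lattice_units a) (unit_group (ring_of_integers F)) ->
  F (a 0 1 / a 0 0).
Proof.
move=> a0 /divring_closedP[F1 FB FV] sF [sub _ fin]; have [di dD FP] := sF.
have [X [Y [XY /andP[e0 e1]]]] := pell_unit di dD.
set e := X%:~R + Y%:~R * d in e0 e1.
have eG n := sqrt_generated_unit_expr n sF XY.
have [i [j [ij eij]]] := @finite_set_repeat _ _
  (fun n => [set e ^+ n * h | h in lattice_units a]) fin (fun n => ex_intro2 _ _ (e ^+ n) (eG n) erefl).
have : [set e ^+ i * h | h in lattice_units a] (e ^+ j).
  by rewrite eij; exists 1; rewrite ?mulr1//; exact/set_mem/(lattice_units_divr_closed a).1.
have en0 : e != 0 by rewrite -normr_gt0.
move=> [h ah eh]; have hE : h = e ^+ (j - i).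
  by apply: (mulfI (expf_neq0 i en0)); rewrite eh -exprD subnKC// ltnW.
have h1 : `|h| < 1.
  by rewrite hE normrX exprn_ilt1// -?lt0n ?subn_gt0.
have [p [q [q0 hpq]]] := lattice_unit_irrational a0 ah h1.
have [_ [Fh _] _] := sub h ah.
have Fint (n : int) : F n%:~R by apply/FP; exists n%:~R, 0; rewrite ratr_int rmorph0 mul0r addr0.
have -> : a 0 1 / a 0 0 = (h - p%:~R) / q%:~R.
  by rewrite hpq addrAC subrr add0r mulrAC mulfV ?intr_eq0// mul1r.
by apply: (FV); [apply: (FB)|].
Qed.

(** The scaled pair is 1 and l = u + v d, with v nonzero since l is irrational; hence [d] is
    recovered from l. *)
Lemma slope_Qbasis F a d (D : int) : Qfree a -> sqrt_generated F d D ->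
  F (a 0 1 / a 0 0) -> Qbasis F ((a 0 0)^-1 *: a).
Proof.
move=> af [di dD FP] Fl; have [a0 li] := (Qfree2P a).1 af.
have b0 : ((a 0 0)^-1 *: a) 0 0 = 1 by rewrite mxE mulVf.
have b1 : ((a 0 0)^-1 *: a) 0 1 = a 0 1 / a 0 0 by rewrite mxE mulrC.
split; first by apply/Qfree2P; rewrite b0 b1 oner_neq0 divr1.
have [u [v lE]] := (FP _).1 Fl; rewrite lE in b1 li.
have v0 : v != 0.
  by apply/eqP => v0; apply: li; exists u => //; rewrite v0 rmorph0 mul0r addr0.
have vR0 : ratr v != 0 :> R by rewrite fmorph_eq0.
apply/seteqP; split=> [x /FP[s [t ->]]|_ [c _ <-]].
  exists (\row_i if i == 0 then s - t * u / v else t / v) => //.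
  by rewrite Qcomb2 b0 b1 !mxE /= rmorphB !fmorph_div rmorphM /=; field.
apply/FP; exists (c 0 0 + c 0 1 * u), (c 0 1 * v).
by rewrite Qcomb2 b0 b1 rmorphD !rmorphM /=; ring.
Qed.

End Converse.

(** Level sets are open with open complement, and the line is connected. No topology is put on [T],
    so the lemma applies to maps into the torus. *)
Lemma locally_constant_eq (R : realType) (T : Type) (f : R -> T) :
  (forall s, \forall t \near s, f t = f s) -> forall s t, f s = f t.
Proof.
move=> fc s t.
have conn : connected [set: R].
  by apply/connected_intervalP => x y _ _ z _.
have level_open (P : set T) : open (f @^-1` P).
  rewrite openE => x Px; rewrite /interior /=.
  by apply: filterS (fc x) => y /= ->.
suff : [set u | f u = f s] = setT by move/seteqP => -[_ /(_ t I)] /= ->.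
apply: conn; first by exists s.
- by exists [set u | f u = f s]; [exact: (level_open [set y | y = f s])|rewrite setTI].
- exists [set u | f u = f s]; last by rewrite setTI.
  rewrite -[X in closed X]setCK; apply: open_closedC.
  exact: (level_open [set y | y <> f s]).
Qed.

(** * The torus as a quotient, and uniqueness of local lifts *)

Section TorusProjection.
Context {R : realType}.
Local Notation V := 'rV[R]_2.

Lemma Z2P (x : V) : reflect (forall i, x 0 i \is a Num.int) (x \in @Z2 R).
Proof. exact: forallP. Qed.

Lemma torus_piP (x y : V) : torus_pi x = torus_pi y <-> x - y \in @Z2 R.
Proof.
rewrite -Quotient.equivE; split=> [/eqP|xy]; first by rewrite piE.
by apply/eqP; rewrite piE.
Qed.

Lemma torus_piD (x y : V) : torus_pi (x + y) = torus_pi x + torus_pi y.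
Proof. by rewrite /torus_pi piE. Qed.

Lemma torus_piB (x y : V) : torus_pi (x - y) = torus_pi x - torus_pi y.
Proof. by rewrite /torus_pi !piE. Qed.

Lemma torus_pi0 : torus_pi (0 : V) = 0.
Proof. by rewrite -[0 in LHS](subrr 0) torus_piB subrr. Qed.

Lemma torus_reprK (p : torus R) : torus_pi (torus_repr p) = p.
Proof. exact: reprK. Qed.

(** The norm is the maximum norm, so every coordinate is an integer of absolute value below one. *)
Lemma Z2_small (x : V) : x \in @Z2 R -> `|x| < 1 -> x = 0.
Proof.
move=> /Z2P Zx x1; apply/matrixP => i j; rewrite !mxE (ord1 i).
have /intrP[m xm] := Zx j.
have : `|x 0 j| < 1.
  apply: le_lt_trans x1; rewrite [leRHS]/Num.Def.normr/= mx_normrE.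
  exact: (le_bigmax _ (fun ij : 'I_1 * 'I_2 => `|x ij.1 ij.2|) (0, j)).
rewrite xm -intr_norm -[1]/(1%:~R) ltr_int.
by have [->|] := eqVneq m 0 => //; rewrite -normr_gt0 gtz0_ge1 leNgt => /negPf ->.
Qed.

(** Otherwise the multiple of [x] of norm 1/2 would contradict [Z2_small]. *)
Lemma Z2_scale_eq0 (x : V) : (forall s : R, s *: x \in @Z2 R) -> x = 0.
Proof.
move=> Zx; apply/eqP/negPn/negP => x0.
have nx : 0 < `|x| by rewrite normr_gt0.
have /eqP : (2 * `|x|)^-1 *: x = 0.
  apply: Z2_small; first exact: Zx.
  rewrite normrZ ger0_norm ?invr_ge0 ?mulr_ge0//.
  by rewrite invfM -mulrA mulVf ?gt_eqF// mulr1 invf_lt1// ltr1n.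
by rewrite scaler_eq0 (negPf x0) orbF invr_eq0 mulf_eq0 pnatr_eq0 (gt_eqF nx).
Qed.

Lemma lift_unique_near (T : topologicalType) (g : T -> V) (x : T) :
  {for x, continuous g} ->
  (\forall y \near x, torus_pi (g y) = torus_pi (g x)) ->
  \forall y \near x, g y = g x.
Proof.
move=> gc gpi; near=> y; apply/eqP; rewrite -subr_eq0; apply/eqP.
apply: Z2_small; first by apply/torus_piP; near: y.
rewrite distrC; near: y.
by have /cvgrPdist_lt := gc; apply.
Unshelve. all: by end_near. Qed.

Lemma derive_shift_origin (f : V -> V) (x v : V) :
  'D_v (f \o shift x) 0 = 'D_v f x.
Proof. by rewrite /derive; congr lim; under eq_fun do rewrite /= addr0 add0r. Qed.

(** The difference of the two shifted lifts is continuous and projects to the constant [p], so it is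
    locally constant and disappears under differentiation. *)
Lemma derive_lift_eq (f g : V -> V) (x y v : V) (p : torus R) :
  {for x, continuous f} -> {for y, continuous g} ->
  (\forall z \near (0 : V), torus_pi (f (z + x)) = torus_pi (g (z + y)) + p) ->
  'D_v f x = 'D_v g y.
Proof.
move=> fc gc fg; rewrite -derive_shift_origin -[RHS]derive_shift_origin.
pose c := f x - g y.
have h0 : \forall z \near (0 : V), (f \o shift x) z - (g \o shift y) z = c.
  have cE : c = (f \o shift x) 0 - (g \o shift y) 0 by rewrite /= !add0r.
  rewrite cE; apply: (@lift_unique_near _ (fun z => (f \o shift x) z - (g \o shift y) z)).
    by move: fc gc; rewrite continuous_shift (continuous_shift g); apply: continuousB.
  have := nbhs_singleton fg; rewrite !add0r => e0.
  apply: filterS fg => z /= e.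
  by rewrite !torus_piB !add0r e e0 ![_ + p]addrC !addrK.
rewrite (@near_eq_derive _ _ _ _ (fun z => (g \o shift y) z + c)).
  by rewrite /derive; congr lim; under eq_fun do rewrite /= opprD addrACA subrr addr0.
by apply: filterS h0 => z <-; rewrite addrC subrK.
Qed.

End TorusProjection.

Lemma is_derive0_cst_on (R : realType) (F : R -> R) (a b : R) : a <= b ->
  (forall x, x \in `[a, b] -> is_derive x 1 F 0) -> F a = F b.
Proof.
move=> ab dF.
have dF' x : x \in `]a, b[ -> is_derive x 1 F ((fun=> 0) x).
  by move=> xab; apply: dF; apply: subset_itv_oo_cc xab.
have Fc : {within `[a, b], continuous F}.
  by apply: derivable_within_continuous => x /dF[].
have [c _ /eqP] := MVT_segment ab dF' Fc.
by rewrite mul0r subr_eq0 => /eqP ->.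
Qed.

(** * The derivative of a smooth torus map *)

Section TangentMap.
Context {R : realType}.
Local Notation V := 'rV[R]_2.
Implicit Types (f : torus R -> torus R) (g : V -> V) (U : set V).

Lemma is_derive_line g (x v : V) (s : R) : derivable g (x + s *: v) v ->
  is_derive s 1 (fun t => g (x + t *: v)) ('D_v g (x + s *: v)).
Proof.
have E : (fun h : R => h^-1 *: (((fun t : R => g (x + t *: v)) \o shift s) (h *: 1)
    - g (x + s *: v))) = (fun h => h^-1 *: ((g \o shift (x + s *: v)) (h *: v) - g (x + s *: v))).
  by apply/funext => h /=; rewrite [h *: 1]mulr1 scalerDl addrCA.
by move=> gd; split; rewrite /derivable /derive E.
Qed.

Definition lift_on f g U :=
  smooth_on U g /\ forall y, U y -> torus_pi (g y) = f (torus_pi y).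

(** Frees [tangent_map] from the unspecified lift chosen by [get], and at the same time allows a
    translation in source and target. *)
Lemma tangent_map_eq f g U (x y v : V) (p : torus R) :
  smooth_map torus_pi torus_pi f -> lift_on f g U -> open U -> U y ->
  (forall z, f (torus_pi (z + x)) = f (torus_pi (z + y)) + p) ->
  tangent_map torus_pi torus_pi f x v = 'D_v g y.
Proof.
move=> fs [gs gU] oU Uy fxy.
have [U' [[oU' U'x] Gs GU']] : local_lift torus_pi torus_pi f x (get (local_lift torus_pi torus_pi f x)).
  by have [g' g'P] := fs x; apply: getPex; exists g'.
apply: (@derive_lift_eq _ _ _ _ _ _ p); [exact: (Gs 0%N).1|exact: (gs 0%N).1|].
have near_shift0 (W : set V) (u : V) : open W -> W u -> \forall z \near (0 : V), W (z + u).
  move=> oW Wu; have : \forall z \near u, W z by exact: open_nbhs_nbhs.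
  by rewrite (near_shift 0) /=; apply: filterS => z; rewrite subr0.
near=> z; rewrite GU' ?gU; first exact: fxy.
- by near: z; apply: near_shift0.
- by near: z; apply: near_shift0.
Unshelve. all: by end_near. Qed.

Lemma tangent_map_lift f g U (x v : V) :
  smooth_map torus_pi torus_pi f -> lift_on f g U -> open U -> U x ->
  tangent_map torus_pi torus_pi f x v = 'D_v g x.
Proof.
by move=> fs gf oU Ux; apply: (@tangent_map_eq f g U x x v 0 fs gf) => // z; rewrite addr0.
Qed.

Lemma smooth_mapP f : smooth_map torus_pi torus_pi f ->
  forall x, exists g U, [/\ lift_on f g U, open U & U x].
Proof. by move=> fs x; have [g [U [[oU Ux] gs gU]]] := fs x; exists g, U. Qed.

Lemma tangent_map_shift f (x y v : V) (p : torus R) :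
  smooth_map torus_pi torus_pi f ->
  (forall z, f (torus_pi (z + x)) = f (torus_pi (z + y)) + p) ->
  tangent_map torus_pi torus_pi f x v = tangent_map torus_pi torus_pi f y v.
Proof.
move=> fs fxy; have [g [U [gf oU Uy]]] := smooth_mapP fs y.
by rewrite (tangent_map_eq v fs gf oU Uy fxy) (tangent_map_lift v fs gf).
Qed.

Lemma tangent_map_Z2 f (x y v : V) : smooth_map torus_pi torus_pi f ->
  x - y \in @Z2 R ->
  tangent_map torus_pi torus_pi f x v = tangent_map torus_pi torus_pi f y v.
Proof.
move=> fs xy; apply: (@tangent_map_shift f x y v 0) => // z; rewrite addr0.
by congr f; apply/torus_piP; rewrite opprD addrACA subrr add0r.
Qed.

(** The chosen lift may change from point to point, but near [x] a single C^1 lift computes all the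
    derivatives. *)
Lemma tangent_map_continuous f (v : V) : smooth_map torus_pi torus_pi f ->
  continuous (fun x => tangent_map torus_pi torus_pi f x v : V).
Proof.
move=> fs x; have [g [U [gf oU Ux]]] := smooth_mapP fs x.
rewrite /continuous_at (tangent_map_lift v fs gf oU Ux).
have Dc : {for x, continuous ('D_v g)} by exact: ((gf.1 1%N).2 v).2.1.
apply: cvg_trans Dc; apply: (@near_eq_cvg V V (nbhs x)).
have nU : \forall y \near x, U y by exact: open_nbhs_nbhs.
by near=> y; rewrite (tangent_map_lift v fs gf oU)//; near: y.
Unshelve. all: by end_near. Qed.

(** Integration along a line: the defect [c] is locally constant, because a local lift minus t w has
    zero derivative along [v]. *)
Lemma tangent_map_cst_line f (v w : V) : smooth_map torus_pi torus_pi f ->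
  (forall y, tangent_map torus_pi torus_pi f y v = w) ->
  forall x (s : R), f (torus_pi (x + s *: v)) = f (torus_pi x) + torus_pi (s *: w).
Proof.
move=> fs fw x s.
pose c (t : R) := f (torus_pi (x + t *: v)) - torus_pi (t *: w).
suff /(_ s 0) : forall s t, c s = c t.
  by rewrite /c !scale0r addr0 torus_pi0 subr0 => <-; rewrite subrK.
apply: locally_constant_eq => s0.
have [g [U [gf oU Ux]]] := smooth_mapP fs (x + s0 *: v).
have lineU : \forall t \near s0, U (x + t *: v).
  have : (x + t *: v) @[t --> s0] --> x + s0 *: v.
    by apply: cvgD; [exact: cvg_cst|apply: cvgZr_tmp; exact: cvg_id].
  by apply; exact: open_nbhs_nbhs.
have [e /= e0 eU] := lineU.
near=> t.
have te : ball s0 e t by near: t; exact: nbhsx_ballx.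
suff E : g (x + t *: v) - t *: w = g (x + s0 *: v) - s0 *: w.
  by rewrite /c -!gf.2//; [rewrite -!torus_piB E|exact: eU].
apply/matrixP => i j; rewrite !mxE (ord1 i){i}.
pose F (u : R) := g (x + u *: v) 0 j - u * w 0 j.
rewrite -[LHS]/(F t) -[RHS]/(F s0).
have dF u : ball s0 e u -> is_derive u 1 F 0.
  move=> /eU Uu; rewrite /F.
  have gd : derivable g (x + u *: v) v by exact: ((gf.1 1%N).2 v).1.
  have [d1 d2] := is_derive_line gd.
  rewrite -(tangent_map_lift v fs gf oU Uu) fw derive_mx// in d2.
  have dj : is_derive u 1 (fun t => g (x + t *: v) 0 j) (w 0 j).
    by split; [exact: ((derivable_mxP _ _ _).1 d1 0 j)|rewrite -d2 mxE].
  have dl : is_derive u 1 (fun t : R => t * w 0 j) (w 0 j).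
    apply: is_derive_eq; by rewrite scaler0 add0r [_ *: 1]mulr1.
  by apply: is_derive_eq; rewrite subrr.
have ball_conv a b u : ball s0 e a -> ball s0 e b -> u \in `[a, b] -> ball s0 e u.
  rewrite -!ball_normE /= in_itv /= !ltr_distlC => /andP[a1 a2] /andP[b1 b2] /andP[u1 u2].
  by rewrite (lt_le_trans a1)//= (le_lt_trans u2).
have s0e : ball s0 e s0 by exact: ballxx.
have [ts|/ltW st] := leP t s0; [|apply: esym].
  by apply: is_derive0_cst_on => // u us; apply: dF; apply: (ball_conv t s0).
by apply: is_derive0_cst_on => // u us; apply: dF; apply: (ball_conv s0 t).
Unshelve. all: by end_near. Qed.

End TangentMap.

(** * Rigidity of maps equivariant along a dense line *)

Section Line.
Context {R : realType}.

(** The choice of [s] makes the first coordinate exact for any [m]; the error in the second is then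
    controlled by [int_span_dense]. *)
Lemma line_dense (a : 'rV[R]_2) : Qfree a -> forall (y : 'rV[R]_2) (e : R), 0 < e ->
  exists s n, n \in @Z2 R /\ `|s *: a + n - y| < e.
Proof.
move=> /Qfree2P[a0 ai] y e e0.
have [m [n mn]] := int_span_dense ai (y 0 1 - y 0 0 * (a 0 1 / a 0 0)) e0.
exists ((y 0 0 + m%:~R) / a 0 0), (\row_i if i == 0 then (- m)%:~R else n%:~R).
split; first by apply/Z2P; apply: ord2P; rewrite mxE /= intr_int.
rewrite [ltLHS]/Num.Def.normr/= mx_normrE bigmax_lt// => -[i j] _ /=.
rewrite (ord1 i){i}; move: j; apply: ord2P; rewrite !mxE/=.
  by rewrite divfK// rmorphN /= -addrA [- _ - _]addrC -opprD subrr normr0.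
by apply: le_lt_trans mn; rewrite le_eqVlt; apply/orP; left; apply/eqP; congr `|_|; field.
Qed.



Local Notation V := 'rV[R]_2.

(** The derivative takes its value at 0 along the whole line R a and its lattice translates; density
    and continuity extend this everywhere. *)
Lemma equivariant_tangent_cst (f : torus R -> torus R) (a b : V) :
  smooth_map torus_pi torus_pi f -> Qfree a ->
  (forall x (s : R), f (torus_pi (x + s *: a)) = f (torus_pi x) + torus_pi (s *: b)) ->
  forall v x, tangent_map torus_pi torus_pi f x v = tangent_map torus_pi torus_pi f 0 v.
Proof.
move=> fs af fa v x; set J := fun x => tangent_map torus_pi torus_pi f x v : V.
rewrite -[LHS]/(J x) -[RHS]/(J 0); apply/eqP/negPn/negP => Jx.
have J0 : 0 < `|J x - J 0| by rewrite normr_gt0 subr_eq0.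
have Jc : J z @[z --> x] --> J x by exact: tangent_map_continuous.
have /cvgrPdist_lt/(_ _ J0)/nbhs_normP[e /= e0 eJ] := Jc.
have [s [n [Zn sn]]] := line_dense af x e0.
have := eJ (s *: a + n); rewrite /= [X in is_true (X < e)]distrC => /(_ sn).
suff -> : J (s *: a + n) = J 0 by rewrite ltxx.
apply: (@tangent_map_shift _ f _ _ v (torus_pi (s *: b))) => // z.
rewrite addr0 -fa; congr f; apply/torus_piP.
by rewrite addrA [_ + n]addrC addrK.
Qed.

(** A constant derivative [W] makes [f] affine. Lattice vectors are trivial in the torus, so [W] is
    integral. *)
Lemma equivariant_int_mx (f : torus R -> torus R) (a b : V) :
  smooth_map torus_pi torus_pi f -> Qfree a ->
  (forall x (s : R), f (torus_pi (x + s *: a)) = f (torus_pi x) + torus_pi (s *: b)) ->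
  exists W : 'M[int]_2, a *m map_mx intr W = b.
Proof.
move=> fs af fa.
pose W := \matrix_i tangent_map torus_pi torus_pi f 0 (delta_mx 0 i : V).
have fline i x (s : R) : f (torus_pi (x + s *: delta_mx 0 i)) = f (torus_pi x) + torus_pi (s *: row i W).
  rewrite rowK; apply: tangent_map_cst_line => // y.
  exact: (equivariant_tangent_cst fs af fa).
have fW x : f (torus_pi x) = f (torus_pi 0) + torus_pi (x *m W).
  rewrite mulmx_sum_row [in LHS](row_sum_delta x) !big_ord_recl !big_ord0 !addr0.
  have := fline ord0 0 (x 0 ord0); rewrite add0r => e.
  by rewrite fline e torus_piD addrA.
have W_int i j : W i j \is a Num.int.
  have := fline i 0 1; rewrite add0r !scale1r.
  have -> : torus_pi (delta_mx 0 i : V) = torus_pi 0.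
    by apply/torus_piP/Z2P => k; rewrite subr0 mxE; case: (_ && _).
  rewrite -[LHS]addr0 => /addrI /esym; rewrite -torus_pi0 => /torus_piP/Z2P/(_ j).
  by rewrite subr0 !mxE.
exists (map_mx Num.floor W).
have -> : map_mx intr (map_mx Num.floor W) = W.
  by apply/matrixP => i j; rewrite 2!mxE floorK ?W_int.
(* Comparing the affine formula with equivariance puts every real multiple of a W - b in the
   lattice. *)
apply/eqP; rewrite -subr_eq0; apply/eqP/Z2_scale_eq0 => s.
rewrite scalerBr -torus_piP.
have := fa 0 s; rewrite add0r fW => /addrI <-.
by rewrite scalemxAl.
Qed.

Lemma mulmxr_continuous (W : 'M[R]_2) : continuous (fun x : V => x *m W).
Proof.
under eq_fun do rewrite mulmx_sum_row big_ord_recl big_ord1; move=> x.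
have c i : (fun y : V => y 0 i *: row i W) @ x --> x 0 i *: row i W.
  by apply: (@cvgZ R V V (nbhs x) _ (fun y : V => y 0 i) (cst (row i W))); [exact: coord_continuous|exact: cvg_cst].
exact: (cvgD (c _) (c _)).
Qed.

Lemma is_derive_mulmxr (W : 'M[R]_2) (x v : V) :
  is_derive x v (fun x : V => x *m W) (v *m W).
Proof.
have cW : (fun h : R => h^-1 *: (((fun x : V => x *m W) \o shift x) (h *: v) - x *m W)) @ 0^' --> v *m W.
  apply: (@cvg_trans _ (cst (v *m W) @ 0^')); last exact: cvg_cst.
  apply: near_eq_cvg; near=> h => /=.
  rewrite mulmxDl addrK -scalemxAl scalerA mulVf ?scale1r//.
  by near: h; exact: nbhs_dnbhs_neq.
by split; [apply/cvg_ex; exists (v *m W); exact: cW|apply/cvg_lim => //; exact: cW].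
Unshelve. all: by end_near. Qed.

Lemma smooth_on_cst (U : set V) (c : V) : smooth_on U (cst c).
Proof.
move=> k; elim: k c => [|k IHk] c; split=> //; try by move=> x _; exact: cst_continuous.
move=> v; split; first by move=> x _; exact: derivable_cst.
have -> : 'D_v (cst c : V -> V) = cst 0 by apply/funext => x; exact: derive_cst.
exact: IHk.
Qed.

Lemma smooth_on_mulmxr (U : set V) (W : 'M[R]_2) : smooth_on U (fun x : V => x *m W).
Proof.
case=> [|k]; (split; first by move=> x _; exact: mulmxr_continuous) => //.
move=> v; split; first by move=> x _; have [] := is_derive_mulmxr W x v.
have -> : 'D_v (fun x : V => x *m W) = cst (v *m W).
  by apply/funext => x; have [] := is_derive_mulmxr W x v.
exact: smooth_on_cst.
Qed.

End Line.

(** * Multipliers of the flow and integer matrices *)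

Section MultiplierGroup.
Context {R : realType}.
Local Notation V := 'rV[R]_2.
Local Notation intmx := (map_mx (intr : int -> R)).

(** Each column of the difference is a rational relation between the coordinates of [a]. *)
Lemma Qfree_int_mx_inj (a : V) (W W' : 'M[int]_2) :
  Qfree a -> a *m intmx W = a *m intmx W' -> W = W'.
Proof.
move=> af /eqP; rewrite -subr_eq0 -mulmxBr -map_mxB => /eqP e.
apply/eqP; rewrite -subr_eq0; apply/eqP/matrixP => i j; rewrite [RHS]mxE.
have /rowP/(_ i) : \row_i ((W - W') i j)%:~R = 0 :> 'rV[rat]_2.
  apply: af; move/rowP: e => /(_ j); rewrite !mxE => <-.
  by apply: eq_bigr => k _; rewrite !mxE ratr_int mulrC.
by rewrite !mxE => /eqP; rewrite intr_eq0 => /eqP.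
Qed.

Lemma Z2_mulmx (x : V) (W : 'M[int]_2) : x \in @Z2 R -> x *m intmx W \in @Z2 R.
Proof.
move=> /Z2P Zx; apply/Z2P => i; rewrite mxE rpred_sum// => j _.
by rewrite rpredM// mxE intr_int.
Qed.

Definition torus_mulmx (W : 'M[int]_2) (p : torus R) : torus R :=
  torus_pi (torus_repr p *m intmx W).

Lemma torus_mulmx_pi (W : 'M[int]_2) (x : V) :
  torus_mulmx W (torus_pi x) = torus_pi (x *m intmx W).
Proof.
apply/torus_piP; rewrite -mulmxBl; apply: Z2_mulmx.
by apply/torus_piP; rewrite torus_reprK.
Qed.

Lemma torus_mulmx_lift (W : 'M[int]_2) (U : set V) :
  lift_on (torus_mulmx W) (fun x => x *m intmx W) U.
Proof. by split; [exact: smooth_on_mulmxr|move=> y _; rewrite torus_mulmx_pi]. Qed.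

Lemma torus_mulmx_smooth (W : 'M[int]_2) :
  smooth_map torus_pi torus_pi (torus_mulmx W).
Proof.
move=> x; exists (fun x => x *m intmx W), setT.
have [gs gW] := torus_mulmx_lift W setT.
by split=> //; split=> //; exact: openT.
Qed.

Lemma torus_mulmxK (W W' : 'M[int]_2) :
  W *m W' = 1%:M -> cancel (torus_mulmx W) (torus_mulmx W').
Proof.
move=> WW' p; rewrite -[p]torus_reprK !torus_mulmx_pi.
by rewrite -mulmxA -map_mxM WW' map_mx1 mulmx1.
Qed.

Lemma tangent_torus_mulmx (W : 'M[int]_2) (p : torus R) (v : V) :
  torus_tangent (torus_mulmx W) p v = v *m intmx W.
Proof.
rewrite /torus_tangent (tangent_map_lift v (@torus_mulmx_smooth W) (torus_mulmx_lift W setT) openT I).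
by have [] := is_derive_mulmxr (intmx W) (torus_repr p) v.
Qed.

(** Read at the image point, the push-forward condition says that the derivative of [h] sends [a] to
    alpha a everywhere; integrate along lines. *)
Lemma is_multiplier_equivariant psi (a : V) (h : diffeo) (alpha : R) :
  generated_by_constant psi a -> is_multiplier psi h alpha ->
  forall x (s : R), diffeo_fun h (torus_pi (x + s *: a)) =
    diffeo_fun h (torus_pi x) + torus_pi (s *: (alpha *: a)).
Proof.
move=> psia [alpha0 ha]; apply: tangent_map_cst_line => [|y].
  exact: diffeo_fun_smooth.
have := ha (diffeo_fun h (torus_pi y)).
rewrite /push_forward !psia diffeo_funK => <-.
rewrite /torus_tangent; apply: tangent_map_Z2; first exact: diffeo_fun_smooth.
by apply/torus_piP; rewrite torus_reprK.
Qed.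

(** A symmetry and its inverse each yield an integer matrix. Conversely, independence of [a] makes
    the two matrices mutually inverse, and they induce a diffeomorphism. *)
Lemma multiplier_groupP psi (a : V) (alpha : R) :
  generated_by_constant psi a -> Qfree a ->
  multiplier_group psi alpha <->
  [/\ alpha != 0, lattice_ring a alpha & lattice_ring a alpha^-1].
Proof.
move=> psia af; have a0 : a != 0.
  by apply/eqP => a0; have /Qfree2P[] := af; rewrite a0 mxE eqxx.
split=> [[h [beta hbeta] <-]|[alpha0 [W aW] [W' aW']]].
  have hP : is_multiplier psi h (multiplier psi h) by apply: getPex; exists beta.
  move: (multiplier psi h) hP => {}alpha hP; have [alpha0 _] := hP.
  have hE := is_multiplier_equivariant psia hP.
  split => //.
    exact: (equivariant_int_mx (@diffeo_fun_smooth _ h) af hE).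
  apply: (equivariant_int_mx (@diffeo_inv_smooth _ h) af) => x s.
  apply: (can_inj (@diffeo_funK _ h)); rewrite diffeo_invK.
  rewrite -[diffeo_inv h _ in RHS]torus_reprK -torus_piD scalerA hE torus_reprK diffeo_invK.
  by rewrite torus_piD scalerA divfK.
have WW' : W *m W' = 1%:M.
  apply: (Qfree_int_mx_inj af).
  by rewrite map_mxM mulmxA aW -scalemxAl aW' scalerA mulfV// scale1r map_mx1 mulmx1.
have W'W : W' *m W = 1%:M.
  apply: (Qfree_int_mx_inj af).
  by rewrite map_mxM mulmxA aW' -scalemxAl aW scalerA mulVf// scale1r map_mx1 mulmx1.
pose h := Diffeo (torus_mulmxK WW') (torus_mulmxK W'W)
  (@torus_mulmx_smooth W) (@torus_mulmx_smooth W').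
have hP : is_multiplier psi h alpha.
  by split=> // p; rewrite /push_forward !psia /= tangent_torus_mulmx.
exists h; first by exists alpha.
(* The value picked by [get] is [alpha], since a nonzero vector determines its multiplier. *)
have [_ /(_ (torus_pi 0))] : is_multiplier psi h (multiplier psi h) by apply: getPex; exists alpha.
have [_ ->] := hP; rewrite psia => /eqP.
by rewrite -subr_eq0 -scalerBl scaler_eq0 (negPf a0) orbF subr_eq0 => /eqP.
Qed.

End MultiplierGroup.

Theorem corollary4p4 (R : realType) (psi : R -> torus R -> torus R) (F : set R) :
  smooth_flow psi -> quasiperiodic psi -> real_quadratic_field F ->
  (algebraic_flow F psi <->
   finite_index_subgroup (multiplier_group psi) (unit_group (ring_of_integers F))).
Proof.
move=> _ [a [psia af]] [Fd [b Fb]].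
have [a0 _] := (Qfree2P a).1 af.
have -> : multiplier_group psi = lattice_units a.
  by apply/seteqP; split=> x /(multiplier_groupP _ psia af).
split=> [[a' [psia' [theta [theta0 Fa]]]]|fin].
  have {psia'}a'E : a' = a by rewrite -(psia' (torus_pi 0)) psia.
  rewrite {}a'E in Fa.
  have [A [B [C [lABC sF]]]] := Qbasis_sqrt_generated Fd Fa.
  (* Scaling by [theta] leaves the slope unchanged, so the quadratic equation holds for [a]
     itself. *)
  have lE : (theta *: a) 0 1 / (theta *: a) 0 0 = a 0 1 / a 0 0.
    by rewrite !mxE; field; rewrite ?a0 ?theta0.
  rewrite lE in lABC sF.
  apply: (lattice_units_finite_index a0 Fd _ sF); last exact: (lattice_ring_quadratic a0 lABC).
  rewrite -lE; have /divring_closedP[_ _ FV] := Fd.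
  have [_ FE] := Fa; apply: (FV); rewrite FE.
    by exists (\row_i (i == 1)%:R) => //; rewrite Qcomb2 !mxE /= rmorph0 rmorph1 mul0r mul1r add0r.
  by exists (\row_i (i == 0)%:R) => //; rewrite Qcomb2 !mxE /= rmorph0 rmorph1 mul0r mul1r addr0.
have [A [B [C [_ sF]]]] := Qbasis_sqrt_generated Fd Fb.
have Fl := finite_index_slope a0 Fd sF fin.
(* The scaling factor normalizes the first component to 1, which lies in F. *)
exists a; split=> //; exists (a 0 0)^-1; split; first by rewrite invr_eq0.
exact: slope_Qbasis sF Fl.
Qed.
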